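(* There exist universal constants $K>0$ and $d_0\in\mathbb{N}$ such that for every integer $d\ge d_0$, $$c_1(\{0,1\}^d,\mathrm{ED})\ \ge\ \frac{\sqrt{\log d}}{2^{K\sqrt{\log\log d\,\cdot\,\log\log\log d}}},$$ where $\mathrm{ED}$ is the edit distance restricted to $\{0,1\}^d$.
   Context: Edit distance: let $\{0,1\}^*$ be the set of all finite-length binary strings. Consider the graph with vertex set $\{0,1\}^*$ in which $\{x,y\}$ is an edge if $y$ can be obtained from $x$ by deleting one character from $x$ or by inserting one character into $x$. $\mathrm{ED}(x,y)$ is the shortest path distance between $x$ and $y$ in this graph (the minimum number of insertions/deletions of single characters transforming $x$ into $y$). $(\{0,1\}^d,\mathrm{ED})$ is the set of strings of length $d$ with the metric inherited from $(\{0,1\}^*,\mathrm{ED})$. Distortion: for metric spaces $(X,d_X),(Y,d_Y)$ and $f:X\to Y$, $\|f\|_{\mathrm{Lip}}=\sup_{x\ne y} d_Y(f(x),f(y))/d_X(x,y)$. If $f$ is one-to-one, $\mathrm{dist}(f)=\|f\|_{\mathrm{Lip}}\cdot\|f^{-1}\|_{\mathrm{Lip}}$ (with $f^{-1}$ defined on $f(X)$); otherwise $\mathrm{dist}(f)=\infty$. $c_Y(X)=\inf\{\mathrm{dist}(f): f:X\to Y\}$, and $c_1(X)=c_{L_1}(X)$, where $L_1=L_1([0,1])$. *)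

(* Defs.v *)
From HB Require Import structures.
From mathcomp Require Import all_boot all_order all_algebra.
From mathcomp Require Import all_classical all_reals all_analysis.

Set Implicit Arguments.
Unset Strict Implicit.
Unset Printing Implicit Defensive.

Import Order.TTheory GRing.Theory Num.Theory.
Import numFieldNormedType.Exports.

Local Open Scope classical_set_scope.
Local Open Scope ring_scope.

Section EditDistance.
Implicit Types x y z u v : seq bool.

Definition edit_edge x y : Prop :=
  exists u v (b : bool),
    (x = u ++ b :: v /\ y = u ++ v) \/ (x = u ++ v /\ y = u ++ b :: v).

Definition edit_rel : rel (seq bool) := fun x y => `[< edit_edge x y >].

Definition edit_walk x y (n : nat) : bool :=
  `[< exists p, [/\ path edit_rel x p, last x p = y & size p = n] >].

Lemma edit_rel_sym : symmetric edit_rel.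
Proof.
move=> x y; apply/asboolP/asboolP => -[u [v [b [[-> ->]|[-> ->]]]]];
  exists u, v, b; by [left|right].
Qed.

Lemma edit_walk_sym x y n : edit_walk x y n -> edit_walk y x n.
Proof.
move=> /asboolP[p [xp <- <-]]; apply/asboolP; exists (rev (belast x p)); split.
- by rewrite rev_path (eq_path (e' := edit_rel))// => a b; rewrite edit_rel_sym.
- by case: p xp => //= a p _; rewrite rev_cons last_rcons.
- by rewrite size_rev size_belast.
Qed.

Lemma edit_walk_trans y x z m n :
  edit_walk x y m -> edit_walk y z n -> edit_walk x z (m + n).
Proof.
move=> /asboolP[p [xp py <-]] /asboolP[q [yq qz <-]]; apply/asboolP.
by exists (p ++ q); rewrite cat_path last_cat size_cat py xp yq.
Qed.

Lemma edit_walk_nil x : edit_walk x [::] (size x).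
Proof.
elim: x => [|b x IHx]; first by apply/asboolP; exists [::].
rewrite /= -add1n; apply: edit_walk_trans IHx; apply/asboolP; exists [:: x].
by split => //=; rewrite andbT; apply/asboolP; exists [::], x, b; left.
Qed.

Lemma edit_connected x y : exists n, edit_walk x y n.
Proof.
exists (size x + size y)%N.
exact: edit_walk_trans (edit_walk_nil x) (edit_walk_sym (edit_walk_nil y)).
Qed.

Definition ED x y : nat := ex_minn (edit_connected x y).

Lemma ED_walk x y : edit_walk x y (ED x y).
Proof. by rewrite /ED; case: ex_minnP. Qed.

Lemma ED_min x y n : edit_walk x y n -> (ED x y <= n)%N.
Proof. by rewrite /ED; case: ex_minnP => m _; apply. Qed.

Lemma EDxx x : ED x x = 0%N.
Proof.
by apply/eqP; rewrite -leqn0; apply: ED_min; apply/asboolP; exists [::].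
Qed.

Lemma ED_eq0 x y : ED x y = 0%N -> x = y.
Proof. by have := ED_walk x y => /[swap]-> /asboolP[[|? ?] []]. Qed.

Lemma ED_sym x y : ED x y = ED y x.
Proof.
by apply/eqP; rewrite eqn_leq !ED_min//; apply: edit_walk_sym; exact: ED_walk.
Qed.

Lemma ED_triangle y x z : (ED x z <= ED x y + ED y z)%N.
Proof. exact/ED_min/(edit_walk_trans (ED_walk x y))/ED_walk. Qed.

End EditDistance.

(* ({0,1}^d, ED); the phantom argument R is the type of the distances, which
   the instance of metricType R must be able to infer from the carrier *)
Definition edit_cube (R : realType) (d : nat) : Type := d.-tuple bool.

Section EditCube.
Context (R : realType) (d : nat).

HB.instance Definition _ := Choice.on (edit_cube R d).

Definition edit_cube_dist (x y : edit_cube R d) : R :=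
  (ED (x : d.-tuple bool) (y : d.-tuple bool))%:R.

Let distxx x : edit_cube_dist x x = 0.
Proof. by rewrite /edit_cube_dist EDxx. Qed.

Let dist_positivity x y : edit_cube_dist x y = 0 -> x = y.
Proof. by move/eqP; rewrite pnatr_eq0 => /eqP/ED_eq0/val_inj. Qed.

Let dist_sym x y : edit_cube_dist x y = edit_cube_dist y x.
Proof. by rewrite /edit_cube_dist ED_sym. Qed.

Let dist_triangle y x z :
  edit_cube_dist x z <= edit_cube_dist x y + edit_cube_dist y z.
Proof. by rewrite -natrD ler_nat ED_triangle. Qed.

HB.instance Definition _ := @isMetric.Build R (edit_cube R d)
  edit_cube_dist distxx dist_positivity dist_sym dist_triangle.

End EditCube.

Section L1.
Context (R : realType).

Definition leb01 : set (measurableTypeR R) -> \bar R :=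
  mrestr (@lebesgue_measure R) (measurable_itv `[0, 1]).

HB.instance Definition _ := Measure.on leb01.

(* LspaceType1 is made of classes modulo equality leb01-almost everywhere *)
Definition L1 : Type := LspaceType1 leb01.

HB.instance Definition _ := gen_eqMixin L1.
HB.instance Definition _ := gen_choiceMixin L1.

(* a representative of the class f *)
Definition L1_fun (f : L1) : measurableTypeR R -> R := (f : LspaceType1 leb01).

Lemma L1_fun_Lfun f : L1_fun f \in Lfun leb01 1.
Proof.
apply/andP; split; rewrite inE/=; last exact: (@Lebesgue_finite _ _ _ _ _ _ f).
exact: (@measurable_funPT _ _ _ _ (repr (f : {mfun_ leb01, _ >-> _}))).
Qed.

Lemma L1_fun_inj f g : L1_fun f = L1_fun g %[ae leb01] -> f = g.
Proof.
case: f => f [[hf]]; case: g => g [[hg]] fg.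
have efg : f = g.
  rewrite -[f]reprK -[g]reprK; apply/eqquotP; exact/asboolP.
by case: _ / efg hg fg => hg _; rewrite (Prop_irrelevance hf hg).
Qed.

Definition L1_dist (f g : L1) : R :=
  fine ('N[leb01]_1[EFin \o (fun x => L1_fun f x - L1_fun g x)%R])%E.

Let dist_xx f : L1_dist f f = 0.
Proof.
rewrite /L1_dist (_ : _ \o _ = cst 0%E); first by rewrite Lnorm0.
by apply/funext => x /=; rewrite subrr.
Qed.

Let subL f g : (fun x => L1_fun f x - L1_fun g x) \in Lfun leb01 1.
Proof. exact: (rpredB (L1_fun_Lfun f) (L1_fun_Lfun g)). Qed.

Let dist_positivity f g : L1_dist f g = 0 -> f = g.
Proof.
move=> /(@fine_Lnormr_eq0 _ _ _ leb01 _ (lexx _) (Lfun_Sub _ (subL f g))) fg.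
apply: L1_fun_inj; apply: filterS fg => x /(_ Logic.I)/= + _.
by move/eqP; rewrite subr_eq0 => /eqP.
Qed.

Let dist_sym f g : L1_dist f g = L1_dist g f.
Proof.
have := LnormrN (Lfun_Sub (@lexx _ _ 1%E) (subL f g)).
rewrite /L1_dist => <-; congr (fine (Lnorm _ _ _)).
by apply/funext => x /=; rewrite opprB.
Qed.

Let dist_triangle g f h : L1_dist f h <= L1_dist f g + L1_dist g h.
Proof.
have := ler_LnormD (Lfun_Sub (@lexx _ _ 1%E) (subL f g)) (Lfun_Sub _ (subL g h)).
apply: le_trans; rewrite le_eqVlt; apply/orP; left; apply/eqP.
congr (fine (Lnorm _ _ _)); apply/funext => x /=.
by rewrite addrA subrK.
Qed.

HB.instance Definition _ := @isMetric.Build R L1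
  L1_dist dist_xx dist_positivity dist_sym dist_triangle.

End L1.

Section Distortion.
Context {R : realType} {X Y : metricType R}.
Local Open Scope ereal_scope.

(* the suprema are taken in [0, +oo], so that an empty one is 0 *)
Definition Lip_norm (f : X -> Y) : \bar R :=
  maxe 0 (ereal_sup [set (mdist (f p.1) (f p.2) / mdist p.1 p.2)%:E
                    | p in [set p : X * X | p.1 != p.2]]).

(* the Lipschitz norm of the inverse of f, for f one-to-one: the points of the
   domain f(X) of the inverse are written f x, with inverse image x *)
Definition Lip_norm_inv (f : X -> Y) : \bar R :=
  maxe 0 (ereal_sup [set (mdist p.1 p.2 / mdist (f p.1) (f p.2))%:E
                    | p in [set p : X * X | f p.1 != f p.2]]).

Definition distortion (f : X -> Y) : \bar R :=
  if `[< injective f >] then Lip_norm f * Lip_norm_inv f else +oo.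

End Distortion.

Definition least_distortion (R : realType) (Y X : metricType R) : \bar R :=
  ereal_inf (range (@distortion R X Y)).

Definition c1 (R : realType) (X : metricType R) : \bar R :=
  least_distortion (L1 R) X.

(* Main.v *)
Require Import Defs.
From mathcomp Require Import all_boot all_order all_algebra.
From mathcomp Require Import boolp zify ring lra.

(* A bound of order log d is obtained, following Krauthgamer and Rabani.  Let b
   be a cut of the cube {0,1}^d.  If all its influences are at most 9^-k / k^2,
   the Kahn-Kalai-Linial argument shows that k times the proportion of separated
   pairs is at most the total influence.  Otherwise some influence is large, and
   as the cyclic shift changes influences by at most twice the proportion s of
   strings separated from their shift, so are the neighbouring ones, and the
   total influence plus d s is at least k.  When d is exponential in k, both
   cases give a Poincare inequality, which extends from cuts to L_1 because an
   L_1 metric is an average of cuts.  Bit flips and the shift move a string by at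
   most 2 in edit distance, while two random strings are at distance of order
   d; so an embedding into L_1 has distortion of order at least k. *)

Set Implicit Arguments.
Unset Strict Implicit.
Unset Printing Implicit Defensive.

Import Order.TTheory GRing.Theory Num.Theory.

Local Open Scope ring_scope.

(** * Fourier analysis on the cube *)

Section Cube.
Context (R : realFieldType) (n : nat).
Local Notation cube := (n.-tuple bool).
Implicit Types (x y : cube) (j : 'I_n) (S A : {set 'I_n}).

Definition flip j x : cube := [tuple tnth x i (+) (i == j) | i < n].

Lemma tnth_flip j x i : tnth (flip j x) i = tnth x i (+) (i == j).
Proof. by rewrite tnth_mktuple. Qed.

Lemma flipK j : involutive (flip j).
Proof.
by move=> x; apply: eq_from_tnth => i; rewrite !tnth_flip -addbA addbb addbF.
Qed.

Definition avg (f : cube -> R) : R := (\sum_x f x) / (2 ^ n)%:R.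

Lemma card_cube : #|{: cube}| = (2 ^ n)%N.
Proof. by rewrite card_tuple card_bool. Qed.

Lemma pow2n_gt0 : 0 < (2 ^ n)%:R :> R.
Proof. by rewrite ltr0n expn_gt0. Qed.

Lemma eq_avg f g : f =1 g -> avg f = avg g.
Proof. by move=> fg; congr (_ / _); apply: eq_bigr => x _. Qed.

Lemma avgD f g : avg (fun x => f x + g x) = avg f + avg g.
Proof. by rewrite /avg big_split/= mulrDl. Qed.

Lemma avgZ c f : avg (fun x => c * f x) = c * avg f.
Proof. by rewrite /avg -big_distrr/= mulrA. Qed.

Lemma avg_sum (I : Type) (r : seq I) (P : pred I) (f : I -> cube -> R) :
  avg (fun x => \sum_(i <- r | P i) f i x) = \sum_(i <- r | P i) avg (f i).
Proof. by rewrite /avg exchange_big/= mulr_suml. Qed.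

Lemma avg_le f g : (forall x, f x <= g x) -> avg f <= avg g.
Proof.
by move=> fg; rewrite ler_pM2r ?invr_gt0 ?pow2n_gt0//; apply: ler_sum => x _.
Qed.

Lemma avg_ge0 f : (forall x, 0 <= f x) -> 0 <= avg f.
Proof.
by move=> f0; rewrite divr_ge0 ?(ltW pow2n_gt0)//; apply: sumr_ge0 => x _.
Qed.

Lemma avg_cst c : avg (fun=> c) = c.
Proof.
by rewrite /avg sumr_const card_cube -[c *+ _]mulr_natr mulfK//
  pnatr_eq0 expn_eq0.
Qed.

Lemma avg_reindex (h : cube -> cube) f :
  injective h -> avg (fun x => f (h x)) = avg f.
Proof. by move=> hI; rewrite /avg [in RHS](reindex_inj hI). Qed.

Lemma avg_flip j f : avg (fun x => f (flip j x)) = avg f.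
Proof. exact/avg_reindex/inv_inj/flipK. Qed.

Lemma avg_antisym j f : (forall x, f (flip j x) = - f x) -> avg f = 0.
Proof.
move=> fN; have : avg f = - avg f.
  rewrite -[LHS](avg_flip j) -mulN1r -avgZ; apply: eq_avg => x.
  by rewrite fN mulN1r.
by lra.
Qed.

(** The average of [(t * f x - g x) ^+ 2] is a nonnegative quadratic in [t], which is evaluated at
    [t = c / a]. *)
Lemma avg_CS f g :
  avg (fun x => f x * g x) ^+ 2 <=
  avg (fun x => f x ^+ 2) * avg (fun x => g x ^+ 2).
Proof.
set a := avg (fun x => f x ^+ 2); set b := avg (fun x => g x ^+ 2).
set c := avg _.
have a0 : 0 <= a by apply: avg_ge0 => x; apply: sqr_ge0.
have key t : 0 <= a * t ^+ 2 - 2 * t * c + b.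
  rewrite (_ : _ - _ + _ = avg (fun x => (t * f x - g x) ^+ 2)).
    by apply: avg_ge0 => x; apply: sqr_ge0.
  rewrite (_ : _ + b = t ^+ 2 * a + - (2 * t) * c + b); last by ring.
  by rewrite -!avgZ -!avgD; apply: eq_avg => x; ring.
have [a00|/eqP an0] := eqVneq a 0.
  suff -> : c = 0 by rewrite a00 mul0r expr0n.
  (* With [a = 0] the quadratic is affine in [t], and this [t] gives it the value -1. *)
  apply/eqP; apply: contraT => cn0; have := key ((b + 1) / (2 * c)).
  rewrite a00 mul0r; have -> : 2 * ((b + 1) / (2 * c)) * c = b + 1 by field.
  by lra.
have := key (c / a); rewrite -(ler_pM2l (_ : 0 < a)) ?mulr0; last first.
  by rewrite lt_neqAle a0 andbT eq_sym; apply/eqP.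
have -> : a * (a * (c / a) ^+ 2 - 2 * (c / a) * c + b) = a * b - c ^+ 2.
  by field; apply/eqP.
by rewrite subr_ge0.
Qed.

Definition chi S x : R := \prod_(i in S) (-1) ^+ tnth x i.

Lemma chi_flip j S x : chi S (flip j x) = (-1) ^+ (j \in S) * chi S x.
Proof.
have [jS|jNS] := boolP (j \in S); last first.
  rewrite mul1r; apply: eq_bigr => i iS; rewrite tnth_flip.
  by case: eqVneq => [ij|]; [rewrite -ij iS in jNS | rewrite addbF].
rewrite /chi !(bigD1 j jS)/= mulrA tnth_flip eqxx; congr (_ * _).
  by case: (tnth x j); rewrite ?mulrNN ?mulr1 ?expr1 ?expr0.
by apply: eq_bigr => i /andP[_ /negPf ij]; rewrite tnth_flip ij addbF.
Qed.

Lemma chi_sqr S x : chi S x ^+ 2 = 1.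
Proof. by rewrite /chi -prodrXl big1// => i _; rewrite sqrr_sign. Qed.

Lemma chi_setU1 j S x :
  j \notin S -> chi (j |: S) x = (-1) ^+ tnth x j * chi S x.
Proof. by move=> jS; rewrite /chi big_setU1. Qed.

Lemma chi0 x : chi set0 x = 1.
Proof. by rewrite /chi big_set0. Qed.

Lemma avg_chiM S T : avg (fun x => chi S x * chi T x) = (S == T)%:R.
Proof.
case: eqVneq => [->|ST].
  by rewrite -[RHS]avg_cst; apply: eq_avg => x; rewrite -expr2 chi_sqr.
have [j jST] : exists j, (j \in S) != (j \in T).
  apply/existsP; apply: contraNT ST; rewrite negb_exists => /forallP h.
  by apply/eqP/setP => j; apply/eqP; rewrite -[_ == _]negbK.
apply: (@avg_antisym j) => x; rewrite !chi_flip mulrACA.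
by case: (j \in S) jST; case: (j \in T) => //= _; rewrite ?mulr1 ?mul1r mulN1r.
Qed.

Lemma sum_chiM x y : \sum_S chi S x * chi S y = (x == y)%:R * (2 ^ n)%:R.
Proof.
(* Expanding this product over subsets gives the sum; when [x != y], the factor at a differing
   coordinate vanishes. *)
transitivity (\prod_(i < n) ((-1) ^+ tnth x i * (-1) ^+ tnth y i + 1) : R).
  rewrite bigA_distr/=; apply: eq_bigr => S _.
  by rewrite -big_mkcond/= -big_split.
have [->|xy] := eqVneq x y.
  rewrite mul1r (eq_bigr (fun=> 2%:R)) => [|i _]; last first.
    by rewrite -expr2 sqrr_sign.
  by rewrite prodr_const card_ord natrX.
rewrite mul0r; have [i xyi] : exists i, tnth x i != tnth y i.
  apply/existsP; apply: contraNT xy; rewrite negb_exists => /forallP h.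
  by apply/eqP/eq_from_tnth => i; apply/eqP; rewrite -[_ == _]negbK.
rewrite (bigD1 i)//= (_ : _ + 1 = 0) ?mul0r//.
by move: xyi; case: (tnth x i); case: (tnth y i) => //= _;
   rewrite ?mulr1 ?mul1r ?addNr.
Qed.

Definition fourier f S : R := avg (fun x => f x * chi S x).

Lemma fourier_inversion f x : f x = \sum_S fourier f S * chi S x.
Proof.
transitivity (avg (fun y => f y * \sum_S chi S y * chi S x)).
  rewrite /avg (bigD1 x)//= sum_chiM eqxx mul1r big1 ?addr0.
    by rewrite mulfK// gt_eqF// pow2n_gt0.
  by move=> y /negPf yx; rewrite sum_chiM yx mul0r mulr0.
under eq_avg do rewrite mulr_sumr.
rewrite avg_sum; apply: eq_bigr => S _.
rewrite /fourier mulrC -avgZ; apply: eq_avg => y; ring.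
Qed.

(** The two predicates let a derivative, whose terms have [j \in S], be paired with a truncated
    expansion. *)
Lemma plancherel (a b : {set 'I_n} -> R) (P Q : pred {set 'I_n}) :
  avg (fun x => (\sum_(S | P S) a S * chi S x) * (\sum_(S | Q S) b S * chi S x))
  = \sum_(S | P S && Q S) a S * b S.
Proof.
under eq_avg do rewrite mulr_suml.
rewrite avg_sum big_mkcondr/=; apply: eq_bigr => S _.
under eq_avg do rewrite mulr_sumr.
rewrite avg_sum.
transitivity (\sum_(T | Q T) a S * b T * (S == T)%:R).
  apply: eq_bigr => T _; rewrite -avg_chiM -avgZ; apply: eq_avg => x; ring.
case: ifPn => QS.
  rewrite (bigD1 S)//= eqxx mulr1 big1 ?addr0// => T /andP[_ TS].
  by rewrite eq_sym (negPf TS) mulr0.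
by rewrite big1// => T QT; case: eqVneq QS => [->|]; rewrite ?QT ?mulr0.
Qed.

(** One coordinate of the hypercontractive induction. In the expanded fourth power the terms odd in
    the sign average to zero, and Cauchy-Schwarz bounds the mixed term, so the total is at most
    [N0 ^+ 2 + 6 * N0 * N1 + N1 ^+ 2]. *)
Lemma bonami_step j (g0 g1 : cube -> R) (N0 N1 : R) :
  0 <= N0 -> 0 <= N1 ->
  (forall x, g0 (flip j x) = g0 x) -> (forall x, g1 (flip j x) = g1 x) ->
  avg (fun x => g0 x ^+ 4) <= N0 ^+ 2 -> avg (fun x => g1 x ^+ 4) <= N1 ^+ 2 ->
  avg (fun x => (g0 x + (-1) ^+ tnth x j * g1 x) ^+ 4) <= (N0 + 3 * N1) ^+ 2.
Proof.
move=> N0_ge0 N1_ge0 g0j g1j h0 h1.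
set m := avg (fun x => g0 x ^+ 2 * g1 x ^+ 2).
have m_ge0 : 0 <= m by apply: avg_ge0 => x; rewrite mulr_ge0 ?sqr_ge0.
have mle : m <= N0 * N1.
  rewrite -(@ler_pXn2r _ 2)// ?nnegrE ?mulr_ge0//.
  rewrite /m.
  apply: (le_trans (avg_CS _ _)); rewrite exprMn ler_pM//.
  - by apply: avg_ge0 => x; rewrite sqr_ge0.
  - by apply: avg_ge0 => x; rewrite sqr_ge0.
  - by apply: le_trans h0; apply: avg_le => x; rewrite -exprM.
  - by apply: le_trans h1; apply: avg_le => x; rewrite -exprM.
pose odd x := (-1) ^+ tnth x j * (4 * (g0 x ^+ 3 * g1 x + g0 x * g1 x ^+ 3)).
have odd0 : avg odd = 0.
  apply: (@avg_antisym j) => x; rewrite /odd g0j g1j tnth_flip eqxx.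
  by case: (tnth x j) => /=; rewrite ?expr0 ?expr1; ring.
have -> : avg (fun x => (g0 x + (-1) ^+ tnth x j * g1 x) ^+ 4) =
    avg (fun x => g0 x ^+ 4) + 6 * m + avg (fun x => g1 x ^+ 4) + avg odd.
  rewrite /m -avgZ -!avgD; apply: eq_avg => x; rewrite /odd.
  by case: (tnth x j); rewrite ?expr0 ?expr1; ring.
rewrite odd0; nra.
Qed.

Lemma sum_subset_setU1 (V : nmodType) j A (F : {set 'I_n} -> V) : j \notin A ->
  \sum_(S : {set 'I_n} | S \subset j |: A) F S =
  \sum_(S : {set 'I_n} | S \subset A) F S +
  \sum_(S : {set 'I_n} | S \subset A) F (j |: S).
Proof.
move=> jA; rewrite (bigID (fun S : {set 'I_n} => j \in S))/= addrC; congr (_ + _).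
  apply: eq_bigl => S; apply/andP/idP => [[SjA jS]|SA].
    by rewrite -(setU1K jA) subsetD1 SjA jS.
  rewrite (subset_trans SA) ?subsetUr//; split=> //.
  by apply: contra jA; apply/subsetP.
rewrite (reindex_onto (fun S => j |: S) (fun S => S :\ j))/=; last first.
  by move=> S /andP[_ jS]; rewrite setD1K.
apply: eq_bigl => S; rewrite setU11 andbT.
apply/andP/idP => [[SjA /eqP <-]|SA].
  by rewrite -(setU1K jA) setSD.
split; first by rewrite setUS.
by rewrite setU1K//; apply: contra jA; apply/subsetP.
Qed.

(** The (2,4)-hypercontractive inequality, with the noise factor 3^(-1/2) per coordinate moved to
    the right side as the weight [3 ^+ #|S|], so that no square root occurs. Induction on [#|A|]: a
    coordinate [j] splits the sum as [g0 + (-1) ^+ tnth x j * g1], with [g0] and [g1] independent of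
    [j]. *)
Lemma bonami A (a : {set 'I_n} -> R) :
  avg (fun x => (\sum_(S : {set 'I_n} | S \subset A) a S * chi S x) ^+ 4) <=
  (\sum_(S : {set 'I_n} | S \subset A) 3 ^+ #|S| * a S ^+ 2) ^+ 2.
Proof.
have [m cA] : {m | #|A| = m} by exists #|A|.
elim: m A a cA => [|m IHm] A a cA.
  move/cards0_eq: cA => ->.
  have sub0 (F : {set 'I_n} -> R) :
      \sum_(S : {set 'I_n} | S \subset set0) F S = F set0.
    by under eq_bigl do rewrite subset0; rewrite big_pred1_eq.
  rewrite sub0 cards0 mul1r (_ : (_ ^+ 2) ^+ 2 = avg (fun=> a set0 ^+ 4)).
    by apply: avg_le => x; rewrite sub0 chi0 mulr1.
  by rewrite avg_cst -exprM.
have /card_gt0P[j jA] : (0 < #|A|)%N by rewrite cA.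
have jB : j \notin A :\ j by rewrite setD11.
have cB : #|A :\ j| = m by move: (cardsD1 j A); rewrite jA cA => -[].
rewrite -(setD1K jA); set B := A :\ j in jB cB *.
have jS (S : {set 'I_n}) : S \subset B -> j \notin S.
  by move=> SB; apply: contra jB; apply/subsetP.
rewrite sum_subset_setU1//.
have -> : \sum_(S : {set 'I_n} | S \subset B) 3 ^+ #|j |: S| * a (j |: S) ^+ 2 =
    3 * \sum_(S : {set 'I_n} | S \subset B) 3 ^+ #|S| * a (j |: S) ^+ 2.
  rewrite mulr_sumr; apply: eq_bigr => S SB; have jNS := jS _ SB.
  by rewrite cardsU1 jNS add1n exprS mulrA.
have inv (b : {set 'I_n} -> R) x :
    \sum_(S : {set 'I_n} | S \subset B) b S * chi S (flip j x) =
    \sum_(S : {set 'I_n} | S \subset B) b S * chi S x.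
  by apply: eq_bigr => S SB; have /negPf jNS := jS _ SB;
     rewrite chi_flip jNS mul1r.
have pos (b : {set 'I_n} -> R) :
    0 <= \sum_(S : {set 'I_n} | S \subset B) 3 ^+ #|S| * b S ^+ 2.
  by apply: sumr_ge0 => S _; rewrite mulr_ge0 ?sqr_ge0 ?exprn_ge0.
have := @bonami_step j _ _ _ _ (pos a) (pos (fun S => a (j |: S)))
  (inv a) (inv (fun S => a (j |: S))) (IHm _ _ cB) (IHm _ _ cB).
apply: le_trans; apply: avg_le => x; rewrite sum_subset_setU1// mulr_sumr.
rewrite le_eqVlt; apply/orP; left; apply/eqP; congr ((_ + _) ^+ 4).
by apply: eq_bigr => S SB; have jNS := jS _ SB; rewrite chi_setU1// mulrCA.
Qed.

End Cube.

(** * Influences *)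

Section Influence.
Context (R : realFieldType) (n : nat).
Local Notation cube := (n.-tuple bool).
Implicit Types (x y : cube) (j : 'I_n) (S : {set 'I_n}) (b : cube -> bool).

Definition influence b j : R := avg (fun x => (b x != b (flip j x))%:R).

Definition boolR b x : R := (b x)%:R.

Lemma influence_ge0 b j : 0 <= influence b j.
Proof. exact: avg_ge0. Qed.

Lemma fourier_derivative (f : cube -> R) j x :
  \sum_(S : {set 'I_n} | j \in S) fourier f S * chi R S x =
  (f x - f (flip j x)) / 2.
Proof.
rewrite [f x]fourier_inversion [f (flip j x)]fourier_inversion -sumrB.
rewrite mulr_suml [RHS](bigID (fun S : {set 'I_n} => j \in S))/=.
rewrite [X in _ + X]big1 ?addr0 => [|S /negPf jS].
  by apply: eq_bigr => S jS; rewrite chi_flip jS; field.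
by rewrite chi_flip jS mul1r subrr mul0r.
Qed.

(** The derivative of a cut has values 0 and ±1/2, the latter exactly where [b] is sensitive to
    [j]. *)
Lemma influence_fourier b j :
  \sum_(S : {set 'I_n} | j \in S) fourier (boolR b) S ^+ 2 = influence b j / 4.
Proof.
transitivity (\sum_(S : {set 'I_n} | (j \in S) && (j \in S))
    fourier (boolR b) S * fourier (boolR b) S).
  by apply: eq_big => S; rewrite ?andbb.
rewrite -plancherel mulrC -avgZ; apply: eq_avg => x; rewrite fourier_derivative.
by rewrite /boolR; case: (b x); case: (b _) => /=; field.
Qed.

(* Cauchy-Schwarz on the set where [b] is sensitive to [j], of measure
   [influence b j], replaces the usual Hoelder inequality with exponents
   4/3, 4 *)
Lemma low_influence_fourier b j k :
  (\sum_(S : {set 'I_n} | (j \in S) && (#|S| <= k)%N)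
    fourier (boolR b) S ^+ 2) ^+ 2 <= 9 ^+ k * influence b j ^+ 3 / 16.
Proof.
set a := fourier _; set I := influence b j; set W := \sum_(S | _) _.
have I0 : 0 <= I by exact: influence_ge0.
pose low S := (j \in S) && (#|S| <= k)%N.
pose g x := \sum_(S : {set 'I_n} | low S) a S * chi R S x.
pose D x := (boolR b x - boolR b (flip j x)) / 2.
pose B x : R := (b x != b (flip j x))%:R.
have W0 : 0 <= W by apply: sumr_ge0 => S _; exact: sqr_ge0.
(* [D] vanishes where [b] is insensitive to [j], so the indicator [B] may be inserted. *)
have WE : W = avg (fun x => D x * (B x * g x)).
  transitivity (\sum_(S : {set 'I_n} | (j \in S) && low S) a S * a S).
    by apply: eq_bigl => S; rewrite /low andbA andbb.
  rewrite -plancherel; apply: eq_avg => x; rewrite fourier_derivative mulrA.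
  congr (_ * _); rewrite /D /B /boolR.
  by case: (b x); case: (b _) => /=; rewrite ?mulr1 ?mulr0 ?subrr ?mul0r.
have D2 : avg (fun x => D x ^+ 2) = I / 4.
  rewrite /I /influence mulrC -avgZ; apply: eq_avg => x; rewrite /D /boolR.
  by case: (b x); case: (b _) => /=; field.
have B2 : avg (fun x => B x ^+ 2) = I.
  by apply: eq_avg => x; rewrite /B; case: (_ != _); rewrite ?expr1n ?expr0n.
have g4 : avg (fun x => g x ^+ 4) <= (3 ^+ k * W) ^+ 2.
  pose a' S := if low S then a S else 0.
  have := bonami [set: 'I_n] a'.
  have -> : avg (fun x => (\sum_(S : {set 'I_n} | S \subset [set: 'I_n])
      a' S * chi R S x) ^+ 4) = avg (fun x => g x ^+ 4).
    apply: eq_avg => x; congr (_ ^+ 4); rewrite /g [RHS]big_mkcond/=.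
    apply: eq_big => [S|S _]; first by rewrite subsetT.
    by rewrite /a'; case: (low S); rewrite ?mul0r.
  move=> /le_trans; apply; rewrite lerXn2r ?nnegrE ?mulr_ge0 ?exprn_ge0//.
    by apply: sumr_ge0 => S _; rewrite mulr_ge0 ?sqr_ge0 ?exprn_ge0.
  rewrite /W mulr_sumr [leRHS]big_mkcond/= [leLHS](eq_bigl predT)/=; last first.
    by move=> S; rewrite subsetT.
  apply: ler_sum => S _; rewrite /a' /low.
  case: ifP => [/andP[_ Sk]|_]; last by rewrite expr0n mulr0.
  by rewrite ler_wpM2r ?sqr_ge0// ler_weXn2l// ler1n.
have h1 : W ^+ 2 <= I / 4 * avg (fun x => (B x * g x) ^+ 2).
  by rewrite WE -D2; exact: avg_CS.
have h2 : avg (fun x => (B x * g x) ^+ 2) ^+ 2 <= I * (3 ^+ k * W) ^+ 2.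
  rewrite -[in leRHS]B2; apply: (@le_trans _ _
    (avg (fun x => B x ^+ 2) * avg (fun x => (g x ^+ 2) ^+ 2))).
    apply: le_trans (avg_CS _ _); rewrite le_eqVlt; apply/orP; left; apply/eqP.
    congr (_ ^+ 2); apply: eq_avg => x; rewrite exprMn; congr (_ * _).
    by rewrite /B; case: (_ != _); rewrite ?expr1n ?expr0n.
  apply: ler_wpM2l; first by rewrite B2.
  by apply: le_trans g4; apply: avg_le => x; rewrite -exprM.
(* [W] also occurs on the right of the hypercontractive bound; the common factor [W ^+ 2] is
   cancelled at the end, when [W] is nonzero. *)
have h3 : W ^+ 2 * W ^+ 2 <= W ^+ 2 * (9 ^+ k * I ^+ 3 / 16).
  apply: (@le_trans _ _ ((I / 4) ^+ 2 * (avg (fun x => (B x * g x) ^+ 2)) ^+ 2)).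
    rewrite -[leRHS]exprMn -[leLHS]expr2 lerXn2r ?nnegrE ?sqr_ge0//.
    apply: mulr_ge0; first exact: divr_ge0.
    by apply: avg_ge0 => x; exact: sqr_ge0.
  apply: (le_trans (ler_wpM2l (sqr_ge0 _) h2)).
  have -> : 9 ^+ k = (3 ^+ k) ^+ 2 :> R.
    by rewrite -exprM mulnC exprM -[3 ^+ 2]natrX.
  rewrite le_eqVlt; apply/orP; left; apply/eqP.
  by field.
have [W00|Wn0] := eqVneq W 0.
  by rewrite W00 expr0n/= divr_ge0// mulr_ge0 ?exprn_ge0.
by rewrite -(ler_pM2l (_ : 0 < W ^+ 2)) ?exprn_even_gt0.
Qed.

(** A cut separates two independent points with probability twice the variance of its indicator, and
    the variance is the Fourier weight off the empty set. *)
Lemma variance_fourier b :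
  avg (fun x => avg (fun y => (b x != b y)%:R)) =
  2 * \sum_(S : {set 'I_n} | S != set0) fourier (boolR b) S ^+ 2.
Proof.
set f := boolR b.
have e : avg f = fourier f set0.
  by apply: eq_avg => x; rewrite chi0 mulr1.
have p : avg (fun x => f x ^+ 2) = \sum_S fourier f S ^+ 2.
  transitivity (\sum_(S : {set 'I_n} | true && true) fourier f S * fourier f S).
    by rewrite -plancherel; apply: eq_avg => x; rewrite -fourier_inversion.
  by apply: eq_bigr => S _.
have -> : avg (fun x => avg (fun y => (b x != b y)%:R)) =
    avg (fun x => f x ^+ 2) + avg (fun x => f x ^+ 2) - 2 * avg f * avg f.
  transitivity (avg (fun x => (avg (fun x => f x ^+ 2) + f x ^+ 2)
      + (- 2 * avg f) * f x)); last first.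
    by rewrite avgD avgZ avgD avg_cst; ring.
  apply: eq_avg => x.
  transitivity (avg (fun y => f y ^+ 2 + (- 2 * f x) * f y + f x ^+ 2)).
    apply: eq_avg => y; rewrite /f /boolR.
    by case: (b x); case: (b y) => /=; ring.
  by rewrite !avgD avgZ avg_cst; ring.
rewrite p e (bigD1 set0)//=; ring.
Qed.

(** The Fourier weight is split at level [k]. Up to [k], [low_influence_fourier] is summed over [j],
    each nonempty set being counted at least once. Above [k], the weight is at most [k%:R^-1] times
    the sum of [#|S|%:R * a S ^+ 2], which is a quarter of the total influence. *)
Lemma kkl b (k : nat) (eta : R) : (0 < k)%N -> 0 <= eta ->
  (forall j, influence b j <= eta ^+ 2) ->
  avg (fun x => avg (fun y => (b x != b y)%:R)) <=
  (3 ^+ k * eta + k%:R^-1) / 2 * \sum_j influence b j.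
Proof.
move=> k0 eta0 Ieta; rewrite variance_fourier.
set a := fourier _.
have kR : 0 < k%:R :> R by rewrite ltr0n.
have low j : \sum_(S : {set 'I_n} | (j \in S) && (#|S| <= k)%N) a S ^+ 2 <=
    3 ^+ k * eta / 4 * influence b j.
  rewrite -(@ler_pXn2r _ 2)// ?nnegrE; last 2 first.
  - by apply: sumr_ge0 => S _; exact: sqr_ge0.
  - by rewrite mulr_ge0 ?influence_ge0// divr_ge0// mulr_ge0 ?exprn_ge0.
  apply: (le_trans (low_influence_fourier b j k)).
  have -> : 9 ^+ k = (3 ^+ k) ^+ 2 :> R.
    by rewrite -exprM mulnC exprM -[3 ^+ 2]natrX.
  move: (influence b j) (Ieta j) => I Ij.
  (* Only one of the three factors [I] is bounded by [eta ^+ 2], so the square root leaves a bound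
     linear in [I]. *)
  rewrite (_ : _ / 16 = (3 ^+ k * I / 4) ^+ 2 * I); last by field.
  rewrite (_ : (_ * eta / 4 * I) ^+ 2 = (3 ^+ k * I / 4) ^+ 2 * eta ^+ 2).
    by rewrite ler_wpM2l ?sqr_ge0.
  by field.
have swap (P : pred {set 'I_n}) :
    \sum_j \sum_(S : {set 'I_n} | (j \in S) && P S) a S ^+ 2 =
    \sum_(S : {set 'I_n} | P S) #|S|%:R * a S ^+ 2.
  rewrite (exchange_big_dep P)/=; last by move=> j S _ /andP[].
  apply: eq_bigr => S PS; under eq_bigl do rewrite PS andbT.
  by rewrite sumr_const mulr_natl.
have step1 : \sum_(S : {set 'I_n} | (S != set0) && (#|S| <= k)%N) a S ^+ 2 <=
    3 ^+ k * eta / 4 * \sum_j influence b j.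
  rewrite mulr_sumr; apply: le_trans (ler_sum _ (fun j _ => low j)).
  rewrite swap [leLHS]big_mkcond [leRHS]big_mkcond; apply: ler_sum => S _.
  case: (_ <= k)%N; rewrite ?andbF// andbT -cards_eq0.
  have [->|S0] /= := eqVneq #|S| 0%N; first by rewrite mul0r.
  by rewrite ler_peMl ?sqr_ge0// ler1n lt0n.
have step2 : \sum_(S : {set 'I_n} | (S != set0) && ~~ (#|S| <= k)%N) a S ^+ 2 <=
    k%:R^-1 / 4 * \sum_j influence b j.
  have -> : k%:R^-1 / 4 * \sum_j influence b j =
      k%:R^-1 * \sum_(S : {set 'I_n} | true) #|S|%:R * a S ^+ 2.
    rewrite -swap -mulrA; congr (_ * _); rewrite mulr_sumr; apply: eq_bigr => j _.
    by under eq_bigl do rewrite andbT; rewrite influence_fourier mulrC.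
  rewrite ler_pdivlMl// mulr_sumr big_mkcond; apply: ler_sum => S _.
  case: ifP => [/andP[_]|_]; last by rewrite mulr_ge0 ?sqr_ge0.
  by rewrite -ltnNge => /ltnW kS; rewrite ler_wpM2r ?sqr_ge0// ler_nat.
rewrite (bigID (fun S : {set 'I_n} => (#|S| <= k)%N))/=; lra.
Qed.

End Influence.

(** * The cyclic shift and neighbouring influences *)

Section Shift.
Context (R : realFieldType) (n : nat).
Local Notation cube := (n.-tuple bool).
Implicit Types (x y : cube) (j : 'I_n) (b : cube -> bool).

Definition shift x : cube := [tuple tnth x (ordS i) | i < n].

Lemma shift_inj : injective shift.
Proof.
move=> x y xy; apply: eq_from_tnth => i.
by have := congr1 (fun z => tnth z (ord_pred i)) xy; rewrite !tnth_mktuple ord_predK.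
Qed.

Lemma shift_flip j x : shift (flip (ordS j) x) = flip j (shift x).
Proof.
apply: eq_from_tnth => i; rewrite tnth_flip !tnth_mktuple.
by rewrite (inj_eq (bij_inj (@ordS_bij n))).
Qed.

Definition shift_sensitivity b : R := avg (fun x => (b x != b (shift x))%:R).

(** After reindexing by the shift, the edge at [shift x] in direction [j] is the shift of the edge
    at [x] in direction [ordS j]. If the former is cut, so is the latter or one of the two pairs
    joining their endpoints. *)
Lemma influence_ordS b j :
  influence R b j <= influence R b (ordS j) + 2 * shift_sensitivity b.
Proof.
rewrite -[leLHS](avg_reindex _ shift_inj) [2 * _]mulrDl mul1r addrA.
rewrite -[X in _ <= _ + X](avg_flip (ordS j)) -!avgD; apply: avg_le => x.
rewrite shift_flip.
by case: (b x); case: (b _); case: (b _); case: (b _) => /=; lra.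
Qed.

Lemma val_iter_ordS t j : val (iter t (@ordS n) j) = ((j + t) %% n)%N.
Proof.
elim: t => [|t /= ->]; first by rewrite /= addn0 modn_small.
by rewrite -addn1 modnDml addn1 addnS.
Qed.

(** The [m] coordinates following [j] cyclically, from [j] itself on, are distinct, and the
    influence drops by at most [2 * m%:R] times the shift sensitivity along them. *)
Lemma sum_influence_ge b j (m : nat) : (m <= n)%N ->
  m%:R * (influence R b j - 2 * m%:R * shift_sensitivity b) <=
  \sum_i influence R b i.
Proof.
move=> mn; set s := shift_sensitivity b.
have s0 : 0 <= s by exact: avg_ge0.
have step t : influence R b j - 2 * t%:R * s <= influence R b (iter t (@ordS n) j).
  elim: t => [|t IH]; first by rewrite mulr0 mul0r subr0.
  have := influence_ordS b (iter t (@ordS n) j); rewrite iterS -/s -natr1; lra.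
have inj : injective (fun t : 'I_n => iter t (@ordS n) j).
  move=> t u /(congr1 val); rewrite !val_iter_ordS => /eqP.
  by rewrite eqn_modDl !modn_small// => /eqP/val_inj.
rewrite (reindex_inj inj)/= (bigID (fun t : 'I_n => (t < m)%N))/=.
rewrite -[leLHS]addr0 lerD//; last by apply: sumr_ge0 => t _; exact: influence_ge0.
rewrite mulr_natl -[m in _ *+ m]card_ord -sumr_const.
rewrite (big_ord_widen n (fun=> _) mn); apply: ler_sum => t tm.
apply: le_trans (step t); rewrite lerD2l lerN2 ler_wpM2r//.
by rewrite ler_pM2l// ler_nat ltnW.
Qed.

Lemma shift_kkl b (k : nat) : (0 < k)%N -> (3 ^ (10 * k + 2) <= n)%N ->
  k%:R * avg (fun x => avg (fun y => (b x != b y)%:R)) <=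
  \sum_j influence R b j + n%:R * shift_sensitivity b.
Proof.
move=> k0 kn; set V := avg _; set I := \sum_j _; set s := shift_sensitivity b.
have s0 : 0 <= s by exact: avg_ge0.
have kR : 0 < k%:R :> R by rewrite ltr0n.
(* With this choice [3 ^+ k * eta] is [k%:R^-1], and so is the whole factor in [kkl]. *)
pose eta : R := (k%:R * 3 ^+ k)^-1.
have eta0 : 0 < eta by rewrite invr_gt0 mulr_gt0// exprn_gt0.
have [/forallP small|] := boolP [forall j, influence R b j <= eta ^+ 2].
  have := kkl k0 (ltW eta0) small; rewrite -/V -/I.
  have -> : (3 ^+ k * eta + k%:R^-1) / 2 = k%:R^-1 :> R.
    by rewrite /eta; field; rewrite expf_eq0 !pnatr_eq0 -lt0n k0 andbF.
  rewrite ler_pdivlMl// => /le_trans; apply.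
  by rewrite lerDl mulr_ge0.
rewrite negb_forall => /existsP[j]; rewrite -ltNge => etaj.
(* Since [m%:R * eta ^+ 2 = k%:R], an influence above [eta ^+ 2] and its neighbours total at least
   [k], up to a loss [2 * m%:R ^+ 2 * s] that [n%:R * s] absorbs. *)
pose m := (k * (k * 3 ^ k) ^ 2)%N.
have mn : (2 * m ^ 2 <= n)%N.
  apply: leq_trans kn; have k3 : (k <= 3 ^ k)%N by exact/ltnW/ltn_expl.
  have m3 : (m <= 3 ^ (5 * k))%N.
    rewrite (_ : 5 * k = k + (k + k) * 2)%N; last by lia.
    by rewrite expnD expnM leq_mul// leq_exp2r// expnD leq_mul.
  rewrite (_ : 10 * k + 2 = 5 * k * 2 + 2)%N; last by lia.
  by rewrite expnD expnM mulnC leq_mul// leq_exp2r.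
have V1 : V <= 1.
  rewrite -[leRHS](@avg_cst R n); apply: avg_le => x.
  rewrite -[leRHS](@avg_cst R n); apply: avg_le => y; by case: (_ != _).
have mn' : (m <= n)%N.
  by apply: leq_trans mn; rewrite mulSn mul1n expnS expn1; nia.
have := sum_influence_ge b j mn'; rewrite -/I -/s => Im.
have mk : k%:R <= m%:R * influence R b j.
  apply: le_trans (ler_wpM2l (ler0n _ m) (ltW etaj)).
  rewrite /m natrM natrX natrM natrX -mulrA -exprMn /eta mulfV ?expr1n ?mulr1//.
  by rewrite mulf_neq0 ?gt_eqF// exprn_gt0.
have mns : 2 * m%:R ^+ 2 * s <= n%:R * s.
  by rewrite ler_wpM2r// -natrX -natrM ler_nat.
have kV : k%:R * V <= k%:R by rewrite ler_piMr// ltW.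
move: Im; rewrite mulrBr; lra.
Qed.

End Shift.

(** * Edit distance between random strings *)

Section Alignment.
Implicit Types (x y u v : seq bool).

(** The dynamic programming recursion for the insertion-deletion distance, in which equal first
    letters may be matched at no cost. The inner [fix] lets the recursion descend in the second
    string alone. *)
Fixpoint align x : seq bool -> nat :=
  if x isn't a :: x' then size else
  fix align_x y := if y isn't b :: y' then size x else
    let m := (minn (align x' y) (align_x y')).+1 in
    if a == b then minn m (align x' y') else m.

Arguments align : simpl never.

Lemma align_nil x : align x [::] = size x.
Proof. by case: x. Qed.

Lemma align_cons a x b y : align (a :: x) (b :: y) =
  let m := (minn (align x (b :: y)) (align (a :: x) y)).+1 in
  if a == b then minn m (align x y) else m.
Proof. by []. Qed.

Lemma alignxx x : align x x = 0%N.
Proof. by elim: x => // a x IHx; rewrite align_cons eqxx/= IHx minn0. Qed.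

Lemma align_ins u b v y : (align (u ++ b :: v) y <= (align (u ++ v) y).+1)%N.
Proof.
elim: u y => [|a u IHu] y.
  case: y => [|c y]; first by rewrite !align_nil /=.
  by rewrite [_ ++ _]/= align_cons/=; case: ifP => _; lia.
elim: y => [|c y IHy]; first by rewrite !align_nil/= !size_cat/=; lia.
rewrite !cat_cons !align_cons /=.
move: (IHu (c :: y)) (IHu y) IHy; rewrite !cat_cons.
by case: ifP => _; lia.
Qed.

Lemma align_consr x b y : (align x (b :: y) <= (align x y).+1)%N.
Proof. by case: x => [//|a x]; rewrite align_cons/=; case: ifP => _; lia. Qed.

Lemma align_del u b v y : (align (u ++ v) y <= (align (u ++ b :: v) y).+1)%N.
Proof.
elim: u y => [|a u IHu] y.
  elim: y => [|c y IHy]; first by rewrite !align_nil/=; lia.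
  rewrite [_ ++ _]/= [X in (_ <= X.+1)%N]align_cons/=.
  move: (align_consr v c y) IHy => /=.
  by case: ifP => _; lia.
elim: y => [|c y IHy]; first by rewrite !align_nil/= !size_cat/=; lia.
rewrite !cat_cons !align_cons /=.
move: (IHu (c :: y)) (IHu y) IHy; rewrite !cat_cons.
by case: ifP => _; lia.
Qed.

(** One edit of the first string changes [align] by at most one, and [align] vanishes at the end of
    the walk, where the strings agree. *)
Lemma align_le_ED x y : (align x y <= ED x y)%N.
Proof.
have /asboolP[p [xp <- <-]] := ED_walk x y.
elim: p x xp => [|z p IHp] x /=; first by rewrite alignxx.
move=> /andP[/asboolP xz zp].
apply: leq_trans (_ : _ <= (align z (last z p)).+1)%N _.
  case: xz => u [v [b [[-> ->]|[-> ->]]]]; [exact: align_ins|exact: align_del].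
by rewrite ltnS IHp.
Qed.

Lemma edit_edge_walk x y : edit_edge x y -> edit_walk x y 1.
Proof.
move=> xy; apply/asboolP; exists [:: y].
by split; rewrite //= andbT; apply/asboolP.
Qed.

Lemma ED_le2 x y z : edit_edge x z -> edit_edge z y -> (ED x y <= 2)%N.
Proof.
by move=> xz zy; apply: ED_min; apply: (edit_walk_trans (m := 1) (n := 1));
  apply: edit_edge_walk; [exact: xz | exact: zy].
Qed.

Lemma ED_substitution u v (a b : bool) :
  (ED (u ++ a :: v) (u ++ b :: v) <= 2)%N.
Proof.
by apply: (@ED_le2 _ _ (u ++ v)); [exists u, v, a; left|exists u, v, b; right].
Qed.

Lemma ED_rot1 x : (ED x (rot 1 x) <= 2)%N.
Proof.
case: x => [|a x]; first by rewrite EDxx.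
apply: (@ED_le2 _ _ x); rewrite /rot /= ?drop0 ?take0.
  by exists [::], x, a; left.
by exists x, [::], a; right; rewrite cats0.
Qed.

End Alignment.

(** * Exponential moments of the alignment cost *)

Section TypicalDistance.
Context (R : realFieldType).
Implicit Types x : seq bool.

Lemma sum_tupleS (m : nat) (F : seq bool -> R) :
  \sum_(y : m.+1.-tuple bool) F y =
  \sum_(y : m.-tuple bool) F (true :: y) +
  \sum_(y : m.-tuple bool) F (false :: y).
Proof.
transitivity (\sum_b \sum_(y : m.-tuple bool) F (b :: y));
  last by rewrite big_bool.
rewrite (pair_big xpredT xpredT (fun b (y : m.-tuple bool) => F (b :: y)))/=.
rewrite (reindex (fun p : bool * m.-tuple bool => [tuple of p.1 :: p.2]))/=.
  by apply: eq_bigr => -[].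
exists (fun t => (thead t, [tuple of behead t])) => [[b t] _|t _].
  by rewrite /= theadE; congr pair; apply: val_inj.
by rewrite [RHS]tuple_eta.
Qed.

(** Bounding each minimum in [align] by a sum counts all alignments, with weight 1/16 per unit of
    cost. The base 11/10 closes the double induction because (11/10 + 2 · 11/10)/16 + 1 <=
    (11/10)^2. *)
Lemma sum_align_le x (m : nat) :
  \sum_(y : m.-tuple bool) (16^-1 : R) ^+ align x y <=
  (11 / 10) ^+ (size x + m).
Proof.
have le1 k : (16^-1 : R) ^+ k <= (11 / 10) ^+ k.
  by rewrite lerXn2r ?nnegrE//; lra.
elim: x m => [|a x IHx] m.
  rewrite (eq_bigr (fun=> (16^-1 : R) ^+ m));
    last by move=> y _; rewrite /= size_tuple.
  rewrite sumr_const card_tuple card_bool -[_ *+ (2 ^ m)]mulr_natl natrX.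
  rewrite -exprMn add0n.
  by rewrite lerXn2r ?nnegrE//; lra.
elim: m => [|m IHm].
  rewrite (big_pred1 [tuple]) => [|t]; last exact/esym/eqP/tuple0.
  by rewrite align_nil addn0.
pose l : R := 16^-1.
have l0 : 0 <= l by rewrite /l; lra.
have bound b (y : m.-tuple bool) : l ^+ align (a :: x) (b :: y) <=
    l * l ^+ align x (b :: y) + l * l ^+ align (a :: x) y +
    (a == b)%:R * l ^+ align x y.
  have lpos k : 0 <= l ^+ k by rewrite exprn_ge0.
  have h1 := lpos (align x (b :: y)); have h2 := lpos (align (a :: x) y).
  have h3 := lpos (align x y).
  have minS p q : l ^+ (minn p q).+1 <= l * l ^+ p + l * l ^+ q.
    have := lpos p; have := lpos q; rewrite exprS.
    by case: (leqP p q) => _ hq hp; rewrite -mulrDr ler_wpM2l// ?lerDl ?lerDr.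
  have minD p q : l ^+ minn p q <= l ^+ p + l ^+ q.
    by have := lpos p; have := lpos q; case: (leqP p q) => _ hq hp; lra.
  rewrite align_cons/=; case: (a == b); last by rewrite mul0r addr0 minS.
  by rewrite mul1r (le_trans (minD _ _))// lerD2r minS.
rewrite (sum_tupleS _ (fun y => l ^+ align (a :: x) y)).
apply: le_trans (lerD (ler_sum _ (fun y _ => bound true y))
  (ler_sum _ (fun y _ => bound false y))) _.
rewrite !big_split/= -!mulr_sumr.
have := IHx m.+1; have := IHx m; move: IHm.
rewrite (sum_tupleS _ (fun y => l ^+ align x y)) -/l.
rewrite !addnS !addSn !exprS.
set A := \sum_(y : m.-tuple bool) l ^+ align (a :: x) y.
set B := \sum_(y : m.-tuple bool) l ^+ align x y.
set C := \sum_(y : m.-tuple bool) l ^+ align x (true :: y).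
set D := \sum_(y : m.-tuple bool) l ^+ align x (false :: y).
set P := _ ^+ (_ + _).
have P0 : 0 <= P by rewrite exprn_ge0//; lra.
have -> : (a == true)%:R * B = B - (a == false)%:R * B :> R.
  by clear; case: a; rewrite /= ?mul1r ?mul0r; lra.
by rewrite /l; lra.
Qed.

Lemma avg_ED_ge (d : nat) x : size x = d -> (16 <= d)%N ->
  d%:R / 64 <= avg (fun y : d.-tuple bool => (ED x y)%:R) :> R.
Proof.
move=> xd d16; pose r := (d %/ 16)%N; pose l : R := 16^-1.
have r1 : (1 <= r)%N by rewrite /r divn_gt0.
have dr : (d = r * 16 + d %% 16)%N by exact: divn_eq.
have rd : d%:R / 32 <= r%:R :> R.
  by rewrite ler_pdivrMr// -natrM ler_nat; have := ltn_pmod d (isT : 0 < 16)%N; lia.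
have low y : r%:R * (1 - 16 ^+ r * l ^+ align x y) <= (ED x y)%:R :> R.
  have [rE|Er] := leqP r (ED x y).
    apply: le_trans (_ : r%:R <= _); last by rewrite ler_nat.
    rewrite ler_piMr//; rewrite gerBl mulr_ge0 ?exprn_ge0// /l; lra.
  apply: le_trans (ler0n _ _); rewrite mulr_ge0_le0// subr_le0.
  have -> : 16 ^+ r = 16 ^+ (r - align x y) * 16 ^+ align x y :> R.
    by rewrite -exprD subnK// (leq_trans (align_le_ED x y) (ltnW Er)).
  rewrite -mulrA -exprMn /l mulfV ?pnatr_eq0// expr1n mulr1 exprn_ege1//.
  by rewrite ler1n.
apply: le_trans (avg_le low).
rewrite avgZ.
have -> : avg (fun y : d.-tuple bool => 1 - 16 ^+ r * l ^+ align x y) =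
    1 - 16 ^+ r * avg (fun y : d.-tuple bool => l ^+ align x y).
  rewrite -mulNr -avgZ -[X in X + _](@avg_cst R d) -avgD.
  by apply: eq_avg => y; rewrite mulNr.
suff : 16 ^+ r * avg (fun y : d.-tuple bool => l ^+ align x y) <= 2^-1.
  move=> h; have := ler_wpM2l (ler0n R r) h; move: rd; lra.
apply: (@le_trans _ _ (16 ^+ r * ((11 / 10) ^+ (d + d) / 2 ^+ d))).
  rewrite ler_wpM2l ?exprn_ge0//  /avg natrX ler_wpM2r ?invr_ge0 ?exprn_ge0//.
  by rewrite -[X in (X + d)%N]xd sum_align_le.
rewrite addnn -muln2 mulnC exprM -expr_div_n.
(* Here [q] is 121/200. As [d >= 16 * r] and [r >= 1], it suffices that 16 q^16 <= 1/2, which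
   follows from q^8 <= 1/32 and [q <= 1]. *)
set q : R := _ / 2.
have q0 : 0 <= q by rewrite /q; lra.
have q1 : q <= 1 by rewrite /q expr2; lra.
rewrite [X in q ^+ X]dr exprD mulrA [(r * 16)%N]mulnC exprM -exprMn.
apply: (@le_trans _ _ ((16 * q ^+ 16) ^+ r)).
  rewrite ler_piMr//; first by rewrite exprn_ge0// mulr_ge0// exprn_ge0.
  by rewrite exprn_ile1.
have s0 : 0 <= 16 * q ^+ 16 by rewrite mulr_ge0 ?exprn_ge0.
have s1 : 16 * q ^+ 16 <= 2^-1.
  have e2 : q ^+ 2 <= 3 / 8 by rewrite /q !expr2; lra.
  have e4 : q ^+ 4 <= 5 / 32.
    rewrite (exprM q 2 2); apply: le_trans (lerXn2r 2 _ _ e2) _;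
      by rewrite ?nnegrE ?sqr_ge0 ?expr2//; lra.
  have e8 : q ^+ 8 <= 1 / 32.
    rewrite (exprM q 4 2); apply: le_trans (lerXn2r 2 _ _ e4) _;
      by rewrite ?nnegrE ?exprn_ge0 ?expr2//; lra.
  have e16 : q ^+ 16 <= q ^+ 8 by rewrite ler_wiXn2l.
  by lra.
by rewrite (le_trans _ s1)// -[leRHS]expr1 ler_wiXn2l//
  (le_trans s1)// invf_le1 ?ler1n.
Qed.

End TypicalDistance.

(** * From cuts to L_1 *)

Section CutCone.
Context (R : realFieldType) (T : finType) (c : T -> T -> R).
Context (c_cut : forall b : T -> bool,
  0 <= \sum_x \sum_y c x y * (b x != b y)%:R).

(* Lowering the top level of [phi] to the next one removes a nonnegative
   multiple of a cut metric. *)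
Lemma cut_cone_max m (phi : T -> R) x0 : (forall x, phi x <= phi x0) ->
  (#|[set x | (phi x < phi x0)%R]| <= m)%N ->
  0 <= \sum_x \sum_y c x y * `|phi x - phi y|.
Proof.
elim: m phi x0 => [|m IHm] phi x0 phi0 cU.
  have phiE x : phi x = phi x0.
    apply/eqP; rewrite eq_le phi0 leNgt /=; apply/negP => xx0.
    move: cU; rewrite leqn0 cards_eq0 => /eqP/setP/(_ x).
    by rewrite !inE xx0.
  rewrite big1// => x _; rewrite big1// => y _.
  by rewrite !phiE subrr normr0 mulr0.
set U := [set x | (phi x < phi x0)%R] in cU.
have [U0|[x2 x2U]] := set_0Vmem U.
  by apply: (IHm phi x0); rewrite // -/U U0 cards0.
(* [phi x1] is the second largest value of [phi]; [psi] truncates [phi] there, and [b] indicates the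
   top level. *)
have [x1 x1U x1max] := @arg_maxP _ _ _ x2 (mem U) phi x2U.
have x10 : phi x1 < phi x0 by have : x1 \in U := x1U; rewrite inE.
pose psi x := Num.min (phi x) (phi x1).
pose b x := phi x1 < phi x.
have psiE x : phi x = psi x + (phi x0 - phi x1) * (b x)%:R.
  rewrite /psi /b; case: leP => [xx1|x1x].
    by rewrite mulr0 addr0.
  rewrite mulr1 addrC subrK; apply/eqP; rewrite eq_le phi0 leNgt; apply/negP => xx0.
  have : x \in U by rewrite inE.
  by move=> /x1max xx1; have : phi x <= phi x1 := xx1; rewrite leNgt x1x.
have psi0 : psi x0 = phi x1 by rewrite /psi min_r// ltW.
have normE x y : `|phi x - phi y| =
    `|psi x - psi y| + (phi x0 - phi x1) * (b x != b y)%:R.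
  have le1 z : psi z <= phi x1 by rewrite /psi ge_min lexx orbT.
  have eq1 z : b z -> psi z = phi x1 by move=> /ltW; exact: min_r.
  rewrite (psiE x) (psiE y); move: (le1 x) (le1 y) (eq1 x) (eq1 y).
  move: (psi x) (psi y) => px py.
  case: (b x); case: (b y) => /= hx hy ex ey.
  - by rewrite ex// ey// !subrr normr0 mulr0 addr0.
  - by rewrite ex// !ger0_norm; lra.
  - by rewrite ey// !ler0_norm; lra.
  - by rewrite !mulr0 !addr0.
have -> : \sum_x \sum_y c x y * `|phi x - phi y| =
    \sum_x \sum_y c x y * `|psi x - psi y| +
    (phi x0 - phi x1) * \sum_x \sum_y c x y * (b x != b y)%:R.
  rewrite mulr_sumr -big_split; apply: eq_bigr => x _ /=.
  rewrite mulr_sumr -big_split; apply: eq_bigr => y _ /=.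
  by rewrite normE mulrDr mulrCA.
rewrite addr_ge0//; last by rewrite mulr_ge0// subr_ge0 ltW.
apply: (IHm psi x0) => [x|]; first by rewrite psi0 /psi ge_min lexx orbT.
(* The points at level [phi x1] are at the top of [psi], so strictly fewer points lie below the
   maximum. *)
rewrite -ltnS; apply: leq_trans cU; apply: proper_card; apply/properP; split.
  apply/subsetP => x; rewrite !inE psi0 /psi gt_min ltxx orbF => xx1.
  exact: lt_trans x10.
by exists x1; [exact: x1U | rewrite inE psi0 /psi minxx ltxx].
Qed.

Lemma cut_cone (phi : T -> R) : 0 <= \sum_x \sum_y c x y * `|phi x - phi y|.
Proof.
case: (pickP T) => [x _|T0]; last by rewrite big_pred0.
have [x0 _ x0max] := @arg_maxP _ _ _ x xpredT phi isT.
by apply: (@cut_cone_max _ phi x0 _ (leqnn _)) => y; exact: x0max.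
Qed.

End CutCone.

(** * The Poincare inequality as a weighted sum over pairs *)

Section Gap.
Context (R : realFieldType) (n k : nat).
Local Notation cube := (n.-tuple bool).
Implicit Types x y : cube.

(** These signed weights write the difference of the two sides of [shift_kkl] as a linear functional
    of the cut metric, the form required by [cut_cone]. *)
Definition gap_coef x y : R :=
  (\sum_j (y == flip j x)%:R + n%:R * (y == shift x)%:R) / (2 ^ n)%:R -
  k%:R / (2 ^ n)%:R / (2 ^ n)%:R.

Lemma gap_coefE (delta : cube -> cube -> R) :
  \sum_x \sum_y gap_coef x y * delta x y =
  \sum_j avg (fun x => delta x (flip j x)) +
  n%:R * avg (fun x => delta x (shift x)) -
  k%:R * avg (fun x => avg (delta x)).
Proof.
have pick1 x z : \sum_y (y == z)%:R * delta x y = delta x z.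
  rewrite (bigD1 z)//= eqxx mul1r big1 ?addr0// => y /negPf ->.
  by rewrite mul0r.
rewrite -avg_sum -!avgZ -avgD -mulN1r -avgZ -avgD /avg mulr_suml.
apply: eq_bigr => x _.
transitivity (\sum_y ((\sum_j (y == flip j x)%:R * delta x y) / (2 ^ n)%:R +
    n%:R * ((y == shift x)%:R * delta x y) / (2 ^ n)%:R +
    - (k%:R / (2 ^ n)%:R / (2 ^ n)%:R) * delta x y)).
  by apply: eq_bigr => y _; rewrite -mulr_suml /gap_coef; ring.
rewrite !big_split/= -!mulr_suml -!mulr_sumr exchange_big/= pick1.
by under eq_bigr do rewrite pick1; ring.
Qed.

Lemma gap_l1_ge0 (phi : cube -> R) : (0 < k)%N -> (3 ^ (10 * k + 2) <= n)%N ->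
  0 <= \sum_x \sum_y gap_coef x y * `|phi x - phi y|.
Proof.
move=> k0 kn; apply: cut_cone => b; rewrite gap_coefE subr_ge0.
exact: shift_kkl.
Qed.

End Gap.

(** * Edit cost of bit flips and of the shift *)

Section CubeMoves.
Context (n : nat).
Implicit Types x : n.-tuple bool.

Lemma ED_flip (j : 'I_n) x : (ED x (flip j x) <= 2)%N.
Proof.
have split_at (y : n.-tuple bool) :
    tval y = take j y ++ nth false y j :: drop j.+1 y.
  by rewrite -drop_nth ?size_tuple// cat_take_drop.
have nthE (i : nat) : i != j -> nth false (flip j x) i = nth false x i.
  move=> ij; have [ni|iN] := leqP n i; first by rewrite !nth_default ?size_tuple.
  rewrite -!(tnth_nth false _ (Ordinal iN)) tnth_flip.
  by rewrite (_ : (_ == j) = false) ?addbF//; exact/negbTE.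
rewrite [tval x]split_at [tval (flip j x)]split_at.
have -> : take j (flip j x) = take j x.
  apply: (@eq_from_nth _ false) => [|i]; first by rewrite !size_take !size_tuple.
  rewrite size_take size_tuple ltn_ord => ij.
  by rewrite !nth_take// nthE// ltn_eqF.
have -> : drop j.+1 (flip j x) = drop j.+1 x.
  apply: (@eq_from_nth _ false) => [|i _]; first by rewrite !size_drop !size_tuple.
  by rewrite !nth_drop nthE// gtn_eqF// addSn ltnS leq_addr.
exact: ED_substitution.
Qed.

Lemma shift_rot x : shift x = rot 1 x :> seq bool.
Proof.
apply: (@eq_from_nth _ false) => [|i]; first by rewrite size_rot !size_tuple.
rewrite size_tuple => iN; rewrite -(tnth_nth false _ (Ordinal iN)) tnth_mktuple.
rewrite (tnth_nth false)/=; have : size x = n by rewrite size_tuple.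
case: (tval x) => [|a s]; first by rewrite !nth_nil.
move=> /= sn; rewrite rot1_cons nth_rcons -sn.
have : (i < (size s).+1)%N by rewrite sn.
rewrite ltnS leq_eqVlt => /orP[/eqP ->|si].
  by rewrite modnn ltnn eqxx.
by rewrite modn_small// si.
Qed.

Lemma ED_shift x : (ED x (shift x) <= 2)%N.
Proof. by rewrite shift_rot; exact: ED_rot1. Qed.

End CubeMoves.

From mathcomp Require Import all_classical all_reals all_analysis.

Import numFieldNormedType.Exports.

(** * Passing from the line to L_1 *)

Section L1Combination.
Context (R : realType).
Implicit Types f g : L1 R.
Local Notation mu := (@leb01 R).

Lemma integrable_L1_sub f g :
  mu.-integrable setT (EFin \o (fun t => `|L1_fun f t - L1_fun g t|)).
Proof.
have /Lfun1_integrable h : (fun t => L1_fun f t - L1_fun g t) \in Lfun mu 1.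
  exact: (rpredB (L1_fun_Lfun f) (L1_fun_Lfun g)).
exact: (integrable_abse h).
Qed.

Lemma L1_distE f g :
  mdist f g = \int[mu]_t `|L1_fun f t - L1_fun g t|.
Proof. by rewrite -[LHS]/(L1_dist f g) /L1_dist Lnorm1. Qed.

(** Integrability is carried through the induction because splitting the integral requires it. *)
Lemma Rintegral_lincomb (I : Type) (s : seq I) (c : I -> R)
    (h : I -> measurableTypeR R -> R) :
  (forall i, mu.-integrable setT (EFin \o h i)) ->
  mu.-integrable setT (EFin \o (fun t => \sum_(i <- s) c i * h i t)) /\
  \int[mu]_t (\sum_(i <- s) c i * h i t) = \sum_(i <- s) c i * \int[mu]_t h i t.
Proof.
move=> hint; elim: s => [|i s [IHi IHe]].
  rewrite big_nil (_ : (fun t => _) = cst 0); last first.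
    by apply/funext => t; rewrite big_nil.
  by split; [exact: integrable0 | rewrite /Rintegral integral0].
have ci : mu.-integrable setT (EFin \o (fun t => c i * h i t)).
  exact: (integrableZl measurableT (c i) (hint i)).
rewrite big_cons (_ : (fun t => _) =
    (fun t => c i * h i t + \sum_(j <- s) c j * h j t)); last first.
  by apply/funext => t; rewrite big_cons.
split; first exact: (integrableD measurableT ci IHi).
by rewrite RintegralD// RintegralZl// IHe.
Qed.

(** The L_1 distance is the integral over [t] of a line metric, so the hypothesis applies under the
    integral at each [t]. *)
Lemma L1_combination_ge0 (T : finType) (c : T -> T -> R) (F : T -> L1 R) :
  (forall phi : T -> R, 0 <= \sum_x \sum_y c x y * `|phi x - phi y|) ->
  0 <= \sum_x \sum_y c x y * mdist (F x) (F y).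
Proof.
move=> c_ge0; rewrite pair_big/=.
under eq_bigr do rewrite L1_distE.
have [_ <-] := @Rintegral_lincomb _ (index_enum (T * T)%type)
  (fun p => c p.1 p.2) (fun p t => `|L1_fun (F p.1) t - L1_fun (F p.2) t|)
  (fun p => integrable_L1_sub _ _).
apply: Rintegral_ge0 => t _.
by have := c_ge0 (fun x => L1_fun (F x) t); rewrite pair_big.
Qed.

End L1Combination.

(** * Lower bound for the distortion of the edit cube *)

Section Distortion.
Context (R : realType).

(** The distinct points [x0] and [y0] make both Lipschitz norms positive, so an infinite norm makes
    the product infinite; finite norms are admissible [l] and [m]. *)
Lemma distortion_real (X Y : metricType R) (F : X -> Y) (x0 y0 : X) (q : R) :
  x0 != y0 ->
  (forall l m : R, 0 < l -> 0 < m ->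
    (forall x y, mdist (F x) (F y) <= l * mdist x y) ->
    (forall x y, mdist x y <= m * mdist (F x) (F y)) -> q <= l * m) ->
  (q%:E <= distortion F)%E.
Proof.
move=> xy0 hq; rewrite /distortion; case: asboolP => [Finj|_];
  last by rewrite leey.
have dist_gt0 (Z : metricType R) (x y : Z) : x != y -> 0 < mdist x y.
  move=> xy; rewrite lt_neqAle mdist_ge0 andbT eq_sym.
  by apply: contra xy => /eqP/mdist_positivity ->.
have lipE x y : x != y -> ((mdist (F x) (F y) / mdist x y)%:E <= Lip_norm F)%E.
  move=> xy; rewrite /Lip_norm le_max; apply/orP; right.
  by apply: ereal_sup_ubound; exists (x, y).
have invE x y : F x != F y ->
    ((mdist x y / mdist (F x) (F y))%:E <= Lip_norm_inv F)%E.
  move=> xy; rewrite /Lip_norm_inv le_max; apply/orP; right.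
  by apply: ereal_sup_ubound; exists (x, y).
have Fxy x y : x != y -> F x != F y by apply: contra_neq; exact: Finj.
have lip0 : (0 < Lip_norm F)%E.
  by apply: lt_le_trans (lipE _ _ xy0); rewrite lte_fin divr_gt0 ?dist_gt0 ?Fxy.
have inv0 : (0 < Lip_norm_inv F)%E.
  apply: lt_le_trans (invE _ _ (Fxy _ _ xy0)).
  by rewrite lte_fin divr_gt0 ?dist_gt0 ?Fxy.
move: lipE invE lip0 inv0.
case: (Lip_norm F) => [l| |]//; case: (Lip_norm_inv F) => [m| |]//
  lipE invE lip0 inv0.
- rewrite -EFinM lee_fin; apply: hq; rewrite -?lte_fin// => x y.
    have [->|xy] := eqVneq x y; first by rewrite !mdistxx mulr0.
    by have := lipE _ _ xy; rewrite lee_fin ler_pdivrMr ?dist_gt0.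
  have [->|xy] := eqVneq x y; first by rewrite !mdistxx mulr0.
  by have := invE _ _ (Fxy _ _ xy); rewrite lee_fin ler_pdivrMr ?dist_gt0 ?Fxy.
- by rewrite gt0_muley// leey.
- by rewrite gt0_mulye// leey.
- by rewrite mulyy leey.
Qed.

Lemma edit_cube_distortion (d k : nat) (F : edit_cube R d -> L1 R) :
  (0 < k)%N -> (3 ^ (10 * k + 2) <= d)%N -> ((k%:R / 256)%:E <= distortion F)%E.
Proof.
move=> k0 kd; have d16 : (16 <= d)%N.
  apply: leq_trans kd; apply: (@leq_trans (3 ^ 3)) => //.
  by rewrite leq_pexp2l//; lia.
pose bot : edit_cube R d := [tuple false | _ < d].
pose top : edit_cube R d := [tuple true | _ < d].
have bt : bot != top.
  have d_gt0 : (0 < d)%N by exact: leq_trans d16.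
  apply/eqP => /(congr1 (fun z : d.-tuple bool => tnth z (Ordinal d_gt0))).
  by rewrite !tnth_mktuple.
apply: (distortion_real bt) => l m l0 m0 Fl Fm.
have := L1_combination_ge0 F (fun phi => gap_l1_ge0 phi k0 kd).
rewrite (@gap_coefE R d k (fun x y => mdist (F x) (F y))).
set A := \sum_j _; set B := avg _; set C := avg _ => gap.
have le2l (x y : d.-tuple bool) : (ED x y <= 2)%N ->
    mdist (F x) (F y) <= l * 2.
  move=> xy; apply: le_trans (Fl x y) _; rewrite ler_pM2l//.
  by rewrite -[leLHS]/(edit_cube_dist _ _) ler_nat.
have A2 : A <= d%:R * (l * 2).
  rewrite -[d in d%:R]card_ord mulr_natl -sumr_const; apply: ler_sum => j _.
  by rewrite -[leRHS](@avg_cst R d); apply: avg_le => x; exact/le2l/ED_flip.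
have B2 : B <= l * 2.
  by rewrite -[leRHS](@avg_cst R d); apply: avg_le => x; exact/le2l/ED_shift.
have C2 : d%:R / 64 <= m * C.
  rewrite -[leLHS](@avg_cst R d) -avgZ; apply: avg_le => x.
  apply: le_trans (avg_ED_ge R (size_tuple x) d16) _.
  by rewrite -avgZ; apply: avg_le => y; exact: Fm.
have d0 : 0 < d%:R :> R by rewrite ltr0n; lia.
(* The flips and the shift cost at most 4 d l in total, and random pairs are d/64 apart on average,
   so k d / 64 <= m k C <= 4 d l m, whence the constant 256. *)
have h1 : k%:R * C <= d%:R * (l * 2) + d%:R * (l * 2).
  by have := ler_wpM2l (ltW d0) B2; lra.
have h2 := ler_wpM2l (ltW m0) h1.
have h3 := ler_wpM2l (ler0n R k) C2.
rewrite -(ler_pM2l d0); lra.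
Qed.

End Distortion.

(** * Comparison of [k] with the logarithm of [d] *)

Lemma ln_nat_le (R : realType) (d k : nat) :
  (0 < d)%N -> (d <= 3 ^ (10 * k + 12))%N -> ln (d%:R : R) <= 20 * k%:R + 24.
Proof.
move=> d0 dk; apply: (@le_trans _ _ (ln ((3 : R) ^+ (10 * k + 12)))).
  by rewrite ler_ln ?posrE ?ltr0n ?exprn_gt0// -natrX ler_nat.
have ln3 : ln (3 : R) <= 2.
  by have := @le_ln1Dx R 2; rewrite (_ : 1 + 2 = 3) => [|]; [apply; lra | lra].
rewrite lnXn// -[_ *+ (10 * k + 12)]mulr_natl natrD natrM.
have := ler_wpM2l (addr_ge0 (mulr_ge0 (ler0n R 10) (ler0n R k)) (ler0n R 12)) ln3.
by lra.
Qed.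

Theorem theorem4p1 (R : realType) :
  exists (K : R) (d0 : nat), 0 < K /\
    forall d : nat, (d0 <= d)%N ->
      ((Num.sqrt (ln d%:R) /
        2 `^ (K * Num.sqrt (ln (ln d%:R) * ln (ln (ln d%:R)))))%:E
       <= c1 (edit_cube R d))%E.
Proof.
(* From this size on, 20 k + 24 <= 44 k <= (k / 256)^2. *)
have [k0 k0_large] : exists k0 : nat, 44 * (256 * 256) <= k0%:R :> R.
  by exists (44 * (256 * 256))%N; rewrite !natrM.
exists 1, (3 ^ (10 * k0 + 2))%N; split=> // d k0d.
have d0 : (0 < d)%N by rewrite (leq_trans _ k0d)// expn_gt0.
pose t := trunc_log 3 d; pose k := ((t - 2) %/ 10)%N.
have td : (3 ^ t <= d)%N by rewrite trunc_logP.
have dt : (d <= 3 ^ t.+1)%N by rewrite ltnW// trunc_log_ltn.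
have k0t : (10 * k0 + 2 <= t)%N by rewrite trunc_log_max.
have k0k : (k0 <= k)%N by rewrite /k; lia.
have kd : (3 ^ (10 * k + 2) <= d)%N.
  by apply: leq_trans td; rewrite leq_pexp2l// /k; lia.
have dk : (d <= 3 ^ (10 * k + 12))%N.
  by apply: leq_trans dt _; rewrite leq_pexp2l// /k; lia.
have kR : 44 * (256 * 256) <= k%:R :> R by rewrite (le_trans k0_large)// ler_nat.
have k_gt0 : (0 < k)%N by rewrite -(ltr0n R); lra.
apply: (@le_trans _ _ (k%:R / 256)%:E); last first.
  apply: le_ereal_inf_tmp => _ [F _ <-]; exact: edit_cube_distortion.
rewrite lee_fin; apply: (@le_trans _ _ (Num.sqrt (ln d%:R))).
  rewrite ler_pdivrMr ?powR_gt0// ler_peMr ?sqrtr_ge0//.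
  by rewrite -[leLHS](powRr0 2) ler_powR ?mul1r ?sqrtr_ge0// ler1n.
have k256 : 0 <= k%:R / 256 :> R by rewrite divr_ge0.
rewrite -[leRHS]ger0_norm// -sqrtr_sqr ler_wsqrtr//.
apply: (le_trans (ln_nat_le R d0 dk)).
have := ler_wpM2r (ler0n R k) kR; rewrite expr2.
by lra.
Qed.
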